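(* $11\le M(36)\le 15$.
   Context: For a positive integer $n$, $\tau(n)$ denotes the number of positive divisors of $n$. For a positive integer $k$, $M(k)$ denotes the maximal length of a run of consecutive positive integers each having exactly $k$ divisors, i.e. the largest $L$ for which there is a positive integer $n$ with $\tau(n)=\tau(n+1)=\dots=\tau(n+L-1)=k$. *)

(* Defs.v *)
From mathcomp Require Import all_boot.
From mathcomp Require Import boolp classical_sets.

Set Implicit Arguments.
Unset Strict Implicit.
Unset Printing Implicit Defensive.

Local Open Scope nat_scope.

Definition tau (n : nat) : nat := size (divisors n).

Definition equidivisor_run (k n L : nat) : Prop :=
  0 < n /\ forall i, i < L -> tau (n + i) = k.

Definition is_max_run_length (k L : nat) : Prop :=
  (exists n, equidivisor_run k n L) /\
  (forall L' n, equidivisor_run k n L' -> L' <= L).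

(* [xget] returns its default value 0 if no largest [L] exists, so a positive
   lower bound on [M k] entails that the maximum exists and equals [M k]. *)
Definition M (k : nat) : nat := xget 0 [set L | is_max_run_length k L]%classic.

(* Main.v *)
From HB Require Import structures.
From Stdlib Require Import PArith NArith.
Require Import Defs.
From mathcomp Require Import all_boot.
From mathcomp Require Import all_algebra all_field.
From mathcomp Require Import boolp classical_sets.
From mathcomp Require Import zify ring.

Set Implicit Arguments.
Unset Strict Implicit.
Unset Printing Implicit Defensive.

Import GRing.Theory.

Local Open Scope nat_scope.

(** Upper bound. Among 16 consecutive integers one is 8 modulo 16, say 8 m with
m odd. Then 36 = 4 tau(m), so tau(m) = 9 is odd and m is a square s ^ 2. As
s ^ 2 is 1 modulo 8, the number 8 s ^ 2 + 8 is 16 times an odd number and its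
number of divisors is a multiple of 5; it therefore lies outside the run, and
the run must contain the numbers from 8 s ^ 2 - 8 to 8 s ^ 2.
- If 3 divides s, then 8 s ^ 2 - 6 is 6 times a number coprime to 6 which has
  9 divisors, hence is a square, and yet is 2 modulo 3 ([tau_square_sub6]).
- Otherwise write the even neighbours of s as 2 u and 2 ^ j v with u and v odd
  and j > 1, so that u = 2 ^ (j - 1) v + 1 or u = 2 ^ (j - 1) v - 1, and
  8 s ^ 2 - 8 = 2 ^ (j + 4) u v. Since j + 5 divides 36, few values of j remain,
  and the relation between u and v leaves only j = 4 with u and v prime
  ([prime_parts_of_tau36]). One of u and v is divisible by 3, which forces
  s = 47 or s = 49; neither square has 9 divisors ([tau_square_sub8]).

Lower bound. An explicit run of 11 integers near 7 * 10 ^ 57 is given with all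
its factorizations. It comes from a search: the Chinese remainder theorem
imposes on z - 5, ..., z + 5 the factors

  z - 5 : (23 * 37) ^ 2        z + 1 : (5 * 7) ^ 2
  z - 4 : 2 ^ 2 * 5 * 11 ^ 2   z + 2 : 2 * (29 * 43) ^ 2
  z - 3 : 3 ^ 8                z + 3 : 3 * (19 * 31) ^ 2
  z - 2 : 2 * (53 * 61) ^ 2    z + 4 : (2 * 41) ^ 2
  z - 1 : (47 * 59) ^ 2        z + 5 : (13 * 17) ^ 2
  z     : 2 ^ 8 * 3

and then z runs through the resulting residue class until every cofactor is a
prime, or a product of two primes, as the number 36 requires. What remains to be
proved is that the factors, of up to 55 digits, are prime. This is done by
Pocklington's criterion ([prime_of_prime_dvd_mod1], [order_dvd_pred_prime]): if
b has order F modulo each prime divisor r of p, then F divides r - 1, and if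
moreover F is at least the square root of p, then p has no prime divisor up to
its square root. Powers modulo p are computed by Montgomery multiplication, on
binary integers and without division ([mont_powE]). *)

(** * The number of divisors *)

Lemma size_add_divisors f s : size (PrimeDecompAux.add_divisors f s) = f.2.+1 * size s.
Proof.
case: f => p e /=; elim: e => [|e IHe] /=; first by rewrite mul1n.
by rewrite size_merge size_cat size_map IHe mulSn addnC.
Qed.

(** The library builds the list of divisors by running through the prime
factors; each factor p ^ e multiplies its length by e + 1. *)
Lemma tauE n : tau n = \prod_(p <- primes n) (logn p n).+1.
Proof.
have -> : tau n = \prod_(f <- prime_decomp n) f.2.+1.
  rewrite /tau /divisors; elim: (prime_decomp n) => [|f fs IH].
    by rewrite big_nil.
  by rewrite big_cons -IH /= size_add_divisors.
by rewrite prime_decompE big_map.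
Qed.

Lemma tauM m n : 0 < m -> 0 < n -> coprime m n -> tau (m * n) = tau m * tau n.
Proof.
move=> m0 n0 cmn; have perm_mn : perm_eq (primes (m * n)) (primes m ++ primes n).
  apply: uniq_perm; rewrite ?primes_uniq ?cat_uniq ?primes_uniq //=.
    by rewrite -coprime_has_primes // cmn.
  by move=> p; rewrite mem_cat primesM.
rewrite !tauE (perm_big _ perm_mn) big_cat /=; congr (_ * _); apply: eq_big_seq.
  move=> p; rewrite mem_primes => /and3P[p_pr _ pm].
  by rewrite mulnC logn_Gauss // (coprime_dvdl pm).
move=> p; rewrite mem_primes => /and3P[p_pr _ pn].
by rewrite logn_Gauss // (coprime_dvdl pn) // coprime_sym.
Qed.

Lemma tau_pfactor p e : prime p -> tau (p ^ e) = e.+1.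
Proof.
move=> p_pr; rewrite tauE; case: e => [|e]; first by rewrite big_nil.
by rewrite primesX // primes_prime // big_seq1 pfactorK.
Qed.

Lemma tau_2exp_mul e m : odd m -> tau (2 ^ e * m) = e.+1 * tau m.
Proof.
move=> odd_m; have m0 := odd_gt0 odd_m.
by rewrite tauM ?tau_pfactor ?expn_gt0 // coprimeXl // coprime2n.
Qed.

(** The exponents in the factorization of m are one less than factors of
tau m, hence all even. *)
Lemma tau_odd_square m : 0 < m -> odd (tau m) -> exists s, m = s ^ 2.
Proof.
move=> m0 odd_tau; exists (\prod_(p <- primes m) p ^ (logn p m)./2).
rewrite {1}(prod_prime_decomp m0) prime_decompE big_map /=.
rewrite [RHS](big_morph (fun x => x ^ 2) (fun x y => expnMn x y 2) (exp1n 2)).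
apply: eq_big_seq => p pm; rewrite -expnM muln2 halfK.
suff -> : odd (logn p m) = false by rewrite subn0.
apply/negbTE; move: odd_tau; rewrite tauE (big_rem p) //= oddM => /andP[+ _].
by [].
Qed.

Lemma tau_gt1 n : 1 < n -> 1 < tau n.
Proof.
move=> n1; have n0 := ltnW n1.
suff: size [:: 1; n] <= tau n by [].
apply: uniq_leq_size; first by rewrite /= inE andbT neq_ltn n1.
by move=> d; rewrite !inE -dvdn_divisors // => /orP[]/eqP-> //; rewrite dvd1n.
Qed.

Lemma prime_tau2 n : 1 < n -> tau n = 2 -> prime n.
Proof.
move=> n1 tau2; have n0 := ltnW n1.
apply/primeP; split=> // d dn; apply/idPn; rewrite negb_or => /andP[d1 dn'].
have: size [:: 1; d; n] <= tau n; last by rewrite tau2.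
apply: uniq_leq_size; first by rewrite /= !inE negb_or eq_sym d1 dn' neq_ltn n1.
by move=> e; rewrite !inE -dvdn_divisors // => /or3P[]/eqP-> //; rewrite dvd1n.
Qed.

(** * From runs to M *)

(** Sub-runs of runs are runs, so excluding the single length hi + 1 bounds all
lengths, and the maximum that [M] denotes exists. *)
Lemma M_bounds k lo hi :
  (exists n, equidivisor_run k n lo) ->
  (forall n, ~ equidivisor_run k n hi.+1) -> lo <= M k <= hi.
Proof.
move=> run_lo no_run.
have run_le L L' n : L <= L' -> equidivisor_run k n L' -> equidivisor_run k n L.
  by move=> le [n0 run]; split=> // i iL; apply: run; apply: leq_trans le.
have run_hi L n : equidivisor_run k n L -> L <= hi.
  by move=> run; rewrite leqNgt; apply/negP => /run_le-/(_ _ run)/no_run.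
pose P L := `[< exists n, equidivisor_run k n L >].
have exP : exists L, P L by exists lo; apply/asboolP.
have boundP L : P L -> L <= hi by move=> /asboolP[n]; apply: run_hi.
have [L /asboolP runL maxL] := ex_maxnP exP boundP.
have MP : is_max_run_length k (M k).
  apply: (@xgetI _ _ [set L | is_max_run_length k L]%classic L).
  by split=> // L' n run; apply: maxL; apply/asboolP; exists n.
have [n lo_run] := run_lo; have [[m M_run] maxM] := MP.
by rewrite (maxM _ _ lo_run) (run_hi _ _ M_run).
Qed.

(** * No run of length 16 *)

Lemma dvdn4_odd_part k : 0 < k -> 4 %| k -> exists j v, [/\ 1 < j, odd v & k = 2 ^ j * v].
Proof.
move=> k0 k4; have [v + ->] := pfactor_coprime (isT : prime 2) k0.
rewrite coprime2n => odd_v; exists (logn 2 k), v.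
by rewrite odd_v mulnC -(@pfactor_dvdn 2 2).
Qed.

(** The numbers u and v are coprime, as u differs by 1 from 2 ^ (j - 1) v; so
36 is (j + 5) tau(u) tau(v). As tau(u) is at least 2, j is 4, 7 or 13. For v = 1
the number u is 2 ^ (j - 1) + 1 or 2 ^ (j - 1) - 1 and has the wrong number of
divisors; for v > 1 the product tau(u) tau(v) is at least 4, so that j is 4 and
both factors are 2. *)
Lemma prime_parts_of_tau36 u v j : odd u -> odd v -> 1 < j ->
   u.*2 = 2 ^ j * v + 2 \/ 2 ^ j * v = u.*2 + 2 ->
   tau (2 ^ (j + 4) * (u * v)) = 36 ->
   [/\ j = 4, prime u & prime v].
Proof.
move=> odd_u odd_v j1 uv; have v0 := odd_gt0 odd_v; have u0 := odd_gt0 odd_u.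
have uv' : u = (2 ^ j.-1 * v).+1 \/ u.+1 = 2 ^ j.-1 * v.
  by move: uv; case: j j1 => // j _; rewrite expnS /=; lia.
have cuv : coprime u v.
  case: uv' => e; rewrite coprime_sym.
    rewrite e; apply: (@coprime_dvdl _ (2 ^ j.-1 * v)); first exact: dvdn_mull.
    exact: coprimenS.
  apply: (@coprime_dvdl _ u.+1); first by rewrite e dvdn_mull.
  exact: coprimeSn.
rewrite tau_2exp_mul ?oddM ?odd_u // tauM // => tau36.
(* j + 5 is a divisor of 36 exceeding 6. *)
have j_in : j \in [:: 4; 7; 13; 31].
  have dvd36 : (j + 4).+1 %| 36 by rewrite -tau36 dvdn_mulr.
  have: j < 32 by have := dvdn_leq (isT : 0 < 36) dvd36; lia.
  move: j j1 dvd36 {uv uv' tau36}.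
  by do 32 (case=> [//|]).
have u1 : 1 < u.
  have: 2 ^ 3 <= 2 ^ j.-1 by rewrite leq_exp2l //; move: j_in; rewrite !inE; lia.
  nia.
have tau_u := tau_gt1 u1.
have [v1 | v_neq1] := eqVneq v 1.
  have tau1 : tau 1 = 1 by [].
  move: j_in uv' tau36; rewrite v1 tau1 muln1 !inE.
  case/or4P=> /eqP-> /=.
  - have [t7 t9] : tau 7 = 2 /\ tau 9 = 3 by [].
    by case=> [->|[->]]; rewrite ?t7 ?t9.
  - have [t63 t65] : tau 63 = 6 /\ tau 65 = 4 by [].
    by case=> [->|[->]]; rewrite ?t63 ?t65.
  - have p17 : tau (17 * 241) = 4 by rewrite tauM.
    have p13 : tau (13 * (9 * (5 * 7))) = 24 by rewrite !tauM.
    case=> e.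
      have -> : u = 17 * 241 by rewrite e; vm_compute.
      by rewrite p17.
    have -> : u = 13 * (9 * (5 * 7)) by apply: succn_inj; rewrite e; vm_compute.
    by rewrite p13.
  - move=> _ tau_u36; have : 36 * 2 <= 36 * tau u by rewrite leq_mul2l.
    by rewrite -[X in _ <= _ * X]muln1 tau_u36.
have v1 : 1 < v by lia.
have tau_v := tau_gt1 v1.
have j4 : j = 4 by move: j_in tau36; rewrite !inE => /or4P[]/eqP-> //; nia.
move: tau36; rewrite j4 => tau36.
by split=> //; apply: prime_tau2 => //; nia.
Qed.

Lemma tau_8square s : odd s -> tau (8 * s ^ 2) = 36 -> tau (s ^ 2) = 9.
Proof. by move=> odd_s; rewrite (tau_2exp_mul 3) ?oddX ?odd_s //; lia. Qed.

(** Write s = 3 q. Then 8 s ^ 2 - 6 = 6 (12 q ^ 2 - 1), and 12 q ^ 2 - 1 would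
be a square equal to 2 modulo 3. *)
Lemma tau_square_sub6 s : 3 %| s -> odd s -> tau (8 * s ^ 2 - 6) <> 36.
Proof.
case/dvdnP=> q ->; rewrite oddM => /andP[odd_q _].
have q0 := odd_gt0 odd_q.
have -> : 8 * (q * 3) ^ 2 - 6 = 2 ^ 1 * (3 ^ 1 * (12 * q ^ 2 - 1)) by lia.
have odd_m : odd (12 * q ^ 2 - 1) by lia.
rewrite tau_2exp_mul ?oddM ?odd_m // tauM ?tau_pfactor //; try nia; last first.
  by rewrite coprimeXl // prime_coprime //; lia.
move=> tau36; have [r rE] : exists r, 12 * q ^ 2 - 1 = r ^ 2.
  by apply: tau_odd_square; [nia | rewrite (_ : tau _ = 9) //; lia].
have : r ^ 2 %% 3 = 2 by rewrite -rE; nia.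
rewrite -modnXm; have : r %% 3 < 3 by rewrite ltn_mod.
by case: (r %% 3) => [|[|[|]]].
Qed.

(** The even neighbours of s are 2 u and 16 v with u and v prime by
[prime_parts_of_tau36]. Their product is divisible by 3, and u, being at least
8 v - 1, is not 3; so v = 3 and s = 48 - 1 or 48 + 1. *)
Lemma tau_square_sub8 s : ~~ (3 %| s) -> odd s -> 1 < s ->
  tau (8 * s ^ 2) = 36 -> tau (8 * s ^ 2 - 8) <> 36.
Proof.
move=> s3 odd_s s1 /(tau_8square odd_s) tau9 tau36.
suff [sE | sE] : s = 47 \/ s = 49.
- by rewrite sE tau_pfactor in tau9.
- by rewrite sE -[49]/(7 ^ 2) -expnM tau_pfactor in tau9.
have eight_mul : 8 * s ^ 2 - 8 = 8 * (s.-1 * s.+1) by nia.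
have [u [v [j [odd_u odd_v j1 uv sE]]]] : exists u v j, [/\ odd u, odd v, 1 < j,
      u.*2 = 2 ^ j * v + 2 \/ 2 ^ j * v = u.*2 + 2
    & s.-1 * s.+1 = u.*2 * (2 ^ j * v)
      /\ (s.+1 = u.*2 \/ s = u.*2.+1)].
  have [s4 | s4] : 4 %| s.-1 \/ 4 %| s.+1 by lia.
    have [|j [v [j1 odd_v vE]]] := dvdn4_odd_part _ s4; first by lia.
    have s2 : s.+1./2.*2 = s.+1 by lia.
    exists s.+1./2, v, j; rewrite -vE s2 mulnC; split=> //; try (clear -s4 odd_s s1; lia).
  have [|j [v [j1 odd_v vE]]] := dvdn4_odd_part _ s4; first by lia.
  have s2 : s.-1./2.*2 = s.-1 by lia.
  exists s.-1./2, v, j; rewrite -vE s2; split=> //; try (clear -s4 odd_s s1; lia).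
have {}tau36 : tau (2 ^ (j + 4) * (u * v)) = 36.
  by rewrite -tau36 eight_mul (proj1 sE) expnD; congr tau; lia.
have [j4 u_pr v_pr] := prime_parts_of_tau36 odd_u odd_v j1 uv tau36.
have : 3 %| u * v.
  rewrite -(@Gauss_dvdr 3 (2 ^ j.+1)) ?coprimeXr //.
  have -> : 2 ^ j.+1 * (u * v) = s.-1 * s.+1 by rewrite (proj1 sE) expnS; lia.
  have [?|?] : s %% 3 = 1 \/ s %% 3 = 2 by lia.
    by apply: dvdn_mulr; lia.
  by apply: dvdn_mull; lia.
move: uv sE; rewrite j4 Euclid_dvdM // !dvdn_prime2 // => uv sE.
have v1 := prime_gt1 v_pr.
by case/orP=> /eqP E; subst; lia.
Qed.

Lemma no_run16 n : ~ equidivisor_run 36 n 16.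
Proof.
case=> n0 run.
have [i i16 ni8] : exists2 i, i < 16 & (n + i) %% 16 = 8.
  exists ((24 - n %% 16) %% 16); first exact: ltn_pmod.
  by lia.
pose m := (n + i) %/ 8.
have nE : n + i = 8 * m by rewrite /m; lia.
have odd_m : odd m by lia.
have [s sE] : exists s, m = s ^ 2.
  have := run i i16; rewrite nE (tau_2exp_mul 3) // => tau36.
  by apply: tau_odd_square; [lia | rewrite (_ : tau m = 9) //; lia].
rewrite sE in nE odd_m; have odd_s : odd s by rewrite oddX in odd_m.
(* Otherwise 8 s ^ 2 + 8, which is 16 modulo 32, would be in the run. *)
have i8 : 8 <= i.
  rewrite leqNgt; apply/negP => i8; have lt16 : i + 8 < 16 by lia.
  have [k kE] : exists k, s ^ 2 = 8 * k + 1.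
    have s8 : s ^ 2 %% 8 = 1.
      have : s %% 8 \in [:: 1; 3; 5; 7] by rewrite !inE; lia.
      by rewrite -modnXm !inE => /or4P[]/eqP->.
    by exists (s ^ 2 %/ 8); lia.
  have := run _ lt16; rewrite addnA nE.
  have -> : 8 * s ^ 2 + 8 = 2 ^ 4 * (4 * k + 1) by lia.
  by rewrite tau_2exp_mul; lia.
have lt16 d : i - d < 16 by lia.
(* For s = 1 the run would contain 8 s ^ 2 - 8 = 0. *)
have s1 : 1 < s by case: s nE {sE odd_m odd_s} => [|[|s]] //; lia.
have tau0 := run _ i16; rewrite nE in tau0.
have tau6 := run _ (lt16 6); rewrite (_ : n + _ = 8 * s ^ 2 - 6) in tau6; last by lia.
have tau8 := run _ (lt16 8); rewrite (_ : n + _ = 8 * s ^ 2 - 8) in tau8; last by lia.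
have [s3 | s3] := boolP (3 %| s); first exact: tau_square_sub6 tau6.
exact: tau_square_sub8 tau0 tau8.
Qed.

(** * Pocklington's criterion *)

(** The order m of b divides F. If it were smaller, some prime q dividing F / m
would make b ^ (F / q) equal to 1. Finally m divides r - 1 by Fermat. *)
Lemma order_dvd_pred_prime r F (qs : seq nat) (b : 'F_r) :
  prime r -> all prime qs -> F = \prod_(q <- qs) q -> (b ^+ F = 1)%R ->
  {in qs, forall q, (b ^+ (F %/ q) != 1)%R} -> F %| r.-1.
Proof.
move=> r_pr qs_pr FE bF bq.
have F_gt0 : 0 < F.
  rewrite FE big_seq; apply: prodn_cond_gt0 => q q_qs.
  exact: prime_gt0 (allP qs_pr q q_qs).
have [m m_order m_F] := prim_order_exists F_gt0 bF.
have b_neq0 : b != 0%R.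
  apply/eqP => b0; move/eqP: bF.
  by rewrite b0 expr0n eqn0Ngt F_gt0 eq_sym oner_eq0.
have b_fermat : (b ^+ r.-1 == 1)%R.
  apply/eqP/(mulfI b_neq0); rewrite mulr1 -exprS prednK ?prime_gt0 //.
  by have := expf_card b; rewrite card_Fp.
suff -> : F = m by rewrite (prim_order_dvd m_order).
have [k kE] := dvdnP m_F.
have k0 : 0 < k by move: F_gt0; rewrite kE muln_gt0 => /andP[].
have [k1 | k1] := leqP k 1; first by rewrite kE (_ : k = 1) ?mul1n //; lia.
have q_pr := pdiv_prime k1; have q_k := pdiv_dvd k.
move: (pdiv k) q_pr q_k => q q_pr q_k.
have q_qs : q \in qs.
  have : q %| \prod_(d <- qs) d by rewrite -FE kE dvdn_mulr.
  rewrite big_seq; elim/big_ind: _ => [|x y IHx IHy|d d_qs].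
  - by rewrite dvdn1; case: q q_pr {q_k} => [|[]].
  - by rewrite Euclid_dvdM // => /orP[].
  - by rewrite dvdn_prime2 // => [/eqP-> //|]; apply: (allP qs_pr).
case/negP: (bq q q_qs); rewrite -(prim_order_dvd m_order) kE -mulnC.
by rewrite -muln_divA // dvdn_mulr.
Qed.

Lemma prime_of_prime_dvd_mod1 p F : 1 < p -> p < F.+1 ^ 2 ->
  (forall r, prime r -> r %| p -> F %| r.-1) -> prime p.
Proof.
move=> p1 pF dvd_pred; apply: ltn_pdiv2_prime; first exact: ltnW.
apply: leq_trans pF _; rewrite leq_exp2r //.
have r_pr := pdiv_prime p1; rewrite -(prednK (prime_gt0 r_pr)) ltnS.
by apply: dvdn_leq (dvd_pred _ r_pr (pdiv_dvd p)); have := prime_gt1 r_pr; lia.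
Qed.

(** * Montgomery arithmetic on binary integers *)

Lemma pos_eqbP : Equality.axiom Pos.eqb.
Proof. by move=> p q; apply: (iffP idP) => /Pos.eqb_eq. Qed.

HB.instance Definition _ := hasDecEq.Build positive pos_eqbP.

(** Half of t modulo the odd number 2 p' + 1: t / 2, or (t + 2 p' + 1) / 2. *)
Definition half_mod (p' t : positive) : positive :=
  match t with
  | xO s => s
  | xI s => Pos.add_carry s p'
  | xH => Pos.succ p'
  end.

(** The binary digits of f only count halvings: each one but the leading digit
stands for one. The modulus followed by a few zeros is then a natural choice of
f, and no unary counter is needed. *)
Fixpoint halve_repeatedly (f p' t : positive) : positive :=
  match f with
  | xH => t
  | xO g | xI g => halve_repeatedly g p' (half_mod p' t)
  end.

(** (x y + t) / R modulo 2 p' + 1, where R = [radix f]: the schoolbook product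
from the lowest digit of x on, with the accumulator t halved instead of y
doubled. Nothing is ever compared with the modulus. The case f = xH makes the
identity [mont_mulE] hold without a bound on x. *)
Fixpoint mont_mul (f p' x y t : positive) : positive :=
  match f with
  | xH => Pos.add (Pos.mul x y) t
  | xO g | xI g =>
    match x with
    | xH => halve_repeatedly g p' (half_mod p' (Pos.add y t))
    | xO z => mont_mul g p' z y (half_mod p' t)
    | xI z => mont_mul g p' z y (half_mod p' (Pos.add y t))
    end
  end.

Fixpoint radix (f : positive) : positive :=
  match f with xH => xH | xO g | xI g => xO (radix g) end.

(** The initial accumulator is the modulus, that is 0, because 0 is not of type
[positive]. *)
Fixpoint mont_pow (f p' b e : positive) : positive :=
  match e with
  | xH => b
  | xO d => let c := mont_pow f p' b d in mont_mul f p' c c (xI p')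
  | xI d => let c := mont_pow f p' b d in
            mont_mul f p' b (mont_mul f p' c c (xI p')) (xI p')
  end.

Definition residue (F : fieldType) (x : positive) : F := ((Pos.to_nat x)%:R)%R.

Lemma residueO F x : residue F (xO x) = (2 * residue F x)%R.
Proof. by rewrite /residue Pos2Nat.inj_xO multE natrM. Qed.

Lemma residueI F x : residue F (xI x) = (2 * residue F x + 1)%R.
Proof. by rewrite /residue Pos2Nat.inj_xI multE -addn1 natrD natrM. Qed.

Lemma residue1 F : residue F xH = 1%R.
Proof. by []. Qed.

Lemma residueD F x y : residue F (Pos.add x y) = (residue F x + residue F y)%R.
Proof. by rewrite /residue Pos2Nat.inj_add plusE natrD. Qed.

Lemma residueM F x y : residue F (Pos.mul x y) = (residue F x * residue F y)%R.
Proof. by rewrite /residue Pos2Nat.inj_mul multE natrM. Qed.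

Lemma residueS F x : residue F (Pos.succ x) = (residue F x + 1)%R.
Proof. by rewrite /residue Pos2Nat.inj_succ -addn1 natrD. Qed.

Lemma residue_add_carry F x y :
  residue F (Pos.add_carry x y) = (residue F x + residue F y + 1)%R.
Proof. by rewrite Pos.add_carry_spec residueS residueD. Qed.

Definition residueE :=
  (residueO, residueI, residue1, residueD, residueM, residueS, residue_add_carry).

Lemma half_modE F p' t : residue F (xI p') = 0%R ->
  (2 * residue F (half_mod p' t))%R = residue F t.
Proof.
rewrite residueE => p0; case: t => [t|t|] /=; rewrite !residueE //.
  have -> : (2 * (residue F t + residue F p' + 1)
             = 2 * residue F t + 1 + (2 * residue F p' + 1) :> F)%R by ring.
  by rewrite p0 addr0.
have -> : (2 * (residue F p' + 1) = 1 + (2 * residue F p' + 1) :> F)%R by ring.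
by rewrite p0 addr0.
Qed.

Lemma halve_repeatedlyE F f p' t : residue F (xI p') = 0%R ->
  (residue F (radix f) * residue F (halve_repeatedly f p' t))%R = residue F t.
Proof.
move=> p0; elim: f t => [f IH|f IH|] t /=; rewrite ?residue1 ?mul1r //.
all: by rewrite residueO -mulrA IH half_modE.
Qed.

Lemma mont_mulE F f p' x y t : residue F (xI p') = 0%R ->
  (residue F (radix f) * residue F (mont_mul f p' x y t)
   = residue F x * residue F y + residue F t)%R.
Proof.
move=> p0; elim: f x t => [f IH|f IH|] x t /=; last by rewrite residue1 mul1r !residueE.
all: case: x => [x|x|]; rewrite residueO -mulrA ?IH ?halve_repeatedlyE // ?mulrDr.
all: by rewrite half_modE // !residueE; ring.
Qed.

Lemma radix_neq0 F f p' : residue F (xI p') = 0%R -> residue F (radix f) != 0%R.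
Proof.
rewrite residueE => p0.
have two_neq0 : (2 != 0 :> F)%R.
  apply/eqP => two0; move/eqP: p0.
  by rewrite two0 mul0r add0r oner_eq0.
by elim: f => [f IH|f IH|] /=; rewrite ?residue1 ?oner_eq0 // residueO mulf_neq0.
Qed.

(** The integer x represents x / R; in these terms [mont_mul] is the product. *)
Lemma mont_powE F f p' b e : residue F (xI p') = 0%R ->
  (residue F (mont_pow f p' b e) / residue F (radix f)
   = (residue F b / residue F (radix f)) ^+ Pos.to_nat e)%R.
Proof.
move=> p0; have r0 := radix_neq0 f p0.
have mulE x y : (residue F (mont_mul f p' x y (xI p')) / residue F (radix f)
    = (residue F x / residue F (radix f)) * (residue F y / residue F (radix f)))%R.
  have := mont_mulE f x y (xI p') p0; rewrite p0 addr0 => E.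
  by rewrite mulf_div -E -mulf_div divff // mul1r.
elim: e => [e IH|e IH|] /=.
- by rewrite Pos2Nat.inj_xI multE !mulE IH exprS mulnC exprM expr2.
- by rewrite Pos2Nat.inj_xO multE mulE IH mulnC exprM expr2.
- by rewrite expr1.
Qed.

(** * Primality certificates *)

Definition pos_prime (p : positive) : bool := prime (Pos.to_nat p).

(** The conditional, unlike a boolean connective, keeps call-by-value evaluation
from turning a large q into a unary number. *)
Definition known_prime (ps : seq positive) (q : positive) : bool :=
  if Pos.leb q 10000 then pos_prime q else q \in ps.

(** One of the two truncated differences is 0. *)
Definition pos_dist (c d : positive) : N :=
  N.add (N.sub (Npos c) (Npos d)) (N.sub (Npos d) (Npos c)).

Definition pos_prod (qs : seq positive) : positive := foldr Pos.mul xH qs.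

(** Pocklington's criterion with F the product of qs. The element of order F is
b / R, where R is at least 4 p so that intermediate results stay below 2 p. A
power of it is 1 modulo every prime divisor of p if its representative is R
modulo p, and 1 modulo none if the distance to R is coprime to p. *)
Definition pocklington_check (ps : seq positive) (p b : positive)
    (qs : seq positive) : bool :=
  if p is xI p' then
    let f := xO (xO (xO p)) in
    let F := pos_prod qs in
    let dist_pow e := pos_dist (mont_pow f p' b e) (radix f) in
    [&& all (known_prime ps) qs,
        Pos.ltb p (Pos.mul (Pos.succ F) (Pos.succ F)),
        N.eqb (N.modulo (dist_pow F) (Npos p)) 0 &
        all (fun q => if N.div (Npos F) (Npos q) is Npos e
                      then N.eqb (N.gcd (dist_pow e) (Npos p)) 1 else false) qs]
  else false.

Fixpoint check_certificates (ps : seq positive)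
    (cs : seq (positive * positive * seq positive)) : bool :=
  if cs is (p, b, qs) :: cs' then
    pocklington_check ps p b qs && check_certificates (p :: ps) cs'
  else true.

Lemma known_primeP ps q : all pos_prime ps -> known_prime ps q -> pos_prime q.
Proof. by move=> /allP ps_pr; rewrite /known_prime; case: ifP => // _ /ps_pr. Qed.

Lemma to_nat_pos_prod qs :
  Pos.to_nat (pos_prod qs) = \prod_(q <- map Pos.to_nat qs) q.
Proof.
by elim: qs => [|q qs IH]; rewrite ?big_nil // big_cons -IH /= Pos2Nat.inj_mul.
Qed.

Lemma pos_dist_eq_mod r c d : prime r ->
  (r %| N.to_nat (pos_dist c d)) = (residue 'F_r c == residue 'F_r d).
Proof.
move=> r_pr; rewrite /pos_dist /residue N2Nat.inj_add !N2Nat.inj_sub /= plusE !minusE.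
have natr_eq m n : m <= n -> (m%:R == n%:R :> 'F_r)%R = (r %| n - m).
  by move=> mn; rewrite (dvdn_pcharf (pchar_Fp r_pr)) natrB // subr_eq0 eq_sym.
have [cd|/ltnW dc] := leqP (Pos.to_nat c) (Pos.to_nat d).
  by rewrite natr_eq // (eqP cd).
by rewrite eq_sym natr_eq // [X in _ + X](eqP dc) addn0.
Qed.

Lemma pocklington_checkP ps p b qs :
  all pos_prime ps -> pocklington_check ps p b qs -> pos_prime p.
Proof.
move=> ps_pr; case: p => // p'; rewrite /pocklington_check.
set p := xI p'; set f := xO _; set F := pos_prod qs.
case/and4P=> qs_known /Pos.ltb_lt p_lt /N.eqb_eq bF /allP bq.
have qs_pr : all prime (map Pos.to_nat qs).
  by rewrite all_map; apply: sub_all qs_known => q; apply: known_primeP.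
apply: (@prime_of_prime_dvd_mod1 _ (Pos.to_nat F)).
- by rewrite /p Pos2Nat.inj_xI; lia.
- by move: p_lt; lia.
move=> r r_pr r_p.
have p0 : residue 'F_r p = 0%R.
  by apply/eqP; rewrite /residue -(dvdn_pcharf (pchar_Fp r_pr)).
pose x : 'F_r := (residue 'F_r b / residue 'F_r (radix f))%R.
have pow1 e : (x ^+ Pos.to_nat e == 1)%R
    = (r %| N.to_nat (pos_dist (mont_pow f p' b e) (radix f))).
  rewrite pos_dist_eq_mod // -(mont_powE _ _ _ p0).
  have r0 := radix_neq0 f p0; rewrite -(inj_eq (mulIf r0)) mulfVK //.
  by rewrite mul1r.
apply: (@order_dvd_pred_prime r _ (map Pos.to_nat qs) x) => //.
- exact: to_nat_pos_prod.
- apply/eqP; rewrite pow1; apply: dvdn_trans r_p _.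
  have /(congr1 N.to_nat) :=
    N.div_mod' (pos_dist (mont_pow f p' b F) (radix f)) (Npos p).
  by rewrite bF N.add_0_r N2Nat.inj_mul multE => ->; apply: dvdn_mulr.
move=> _ /mapP[q q_qs ->]; move/(_ q q_qs): bq.
case eE: (N.div _ _) => [//|e] /N.eqb_eq gcd1.
have -> : Pos.to_nat F %/ Pos.to_nat q = Pos.to_nat e.
  have /(congr1 N.to_nat) := N.div_mod' (Npos F) (Npos q).
  rewrite eE N2Nat.inj_add N2Nat.inj_mul plusE multE mulnC /= => ->.
  rewrite divnMDl ?divn_small ?addn0 //; last by lia.
  by have := N.mod_lt (Npos F) (Npos q); lia.
rewrite pow1; apply/negP => r_dist.
have rN m : r %| N.to_nat m -> N.divide (N.of_nat r) m.
  by case/dvdnP=> k mE; exists (N.of_nat k); lia.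
have := N.gcd_greatest _ _ _ (rN _ r_dist) (rN (Npos p) r_p).
by rewrite gcd1 => /N.divide_1_r; have := prime_gt1 r_pr; lia.
Qed.

Lemma check_certificatesP ps cs : all pos_prime ps -> check_certificates ps cs ->
  all pos_prime [seq c.1.1 | c <- cs].
Proof.
elim: cs ps => [|[[p b] qs] cs IH] ps //= ps_pr.
case/andP=> /(pocklington_checkP ps_pr) p_pr cs_ok.
by rewrite p_pr; apply: IH cs_ok; rewrite /= p_pr.
Qed.

(** * Runs given by their factorizations *)

Definition pos_factored (fs : seq (positive * nat)) : positive :=
  foldr (fun f t => iter f.2 (Pos.mul f.1) t) xH fs.

Fixpoint check_run (ps : seq positive) (k : nat) (n : positive)
    (fss : seq (seq (positive * nat))) : bool :=
  if fss is fs :: fss' then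
    [&& all (fun f => known_prime ps f.1) fs,
        pairwise (fun f g => Pos.ltb f.1 g.1) fs,
        Pos.eqb (pos_factored fs) n,
        foldr (fun f t => f.2.+1 * t) 1 fs == k
      & check_run ps k (Pos.succ n) fss']
  else true.

Lemma to_nat_pos_factored fs :
  Pos.to_nat (pos_factored fs) = \prod_(f <- fs) Pos.to_nat f.1 ^ f.2.
Proof.
elim: fs => [|[p e] fs IH]; first by rewrite big_nil.
rewrite big_cons -IH /=; elim: e => [|e IHe] /=; first by rewrite mul1n.
by rewrite Pos2Nat.inj_mul IHe expnS -mulnA multE.
Qed.

Lemma tau_factored fs :
  all (fun f => pos_prime f.1) fs -> pairwise (fun f g => Pos.ltb f.1 g.1) fs ->
  tau (Pos.to_nat (pos_factored fs)) = foldr (fun f t => f.2.+1 * t) 1 fs.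
Proof.
rewrite to_nat_pos_factored; elim: fs => [|[p e] fs IH] /=; first by rewrite big_nil.
move=> /andP[p_pr fs_pr] /andP[/allP p_lt fs_lt].
have fs_gt0 : 0 < \prod_(f <- fs) Pos.to_nat f.1 ^ f.2.
  by apply: prodn_gt0 => f; rewrite expn_gt0; lia.
rewrite big_cons /= tauM ?expn_gt0 ?tau_pfactor ?(prime_gt0 p_pr) ?IH //.
apply: coprimeXl; rewrite prime_coprime //; apply/negP.
rewrite big_seq; elim/big_ind: _ => [|x y IHx IHy|[q d] /= qd_fs].
- by rewrite dvdn1; have := prime_gt1 p_pr; lia.
- by rewrite Euclid_dvdM // => /orP[].
- rewrite Euclid_dvdX // dvdn_prime2 //; last exact: (allP fs_pr _ qd_fs).
  by move=> /andP[/eqP pq _]; have /Pos.ltb_lt /= := p_lt _ qd_fs; lia.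
Qed.

Lemma check_runP ps k n fss : all pos_prime ps -> check_run ps k n fss ->
  equidivisor_run k (Pos.to_nat n) (size fss).
Proof.
move=> ps_pr run; split; first by lia.
elim: fss n run => [|fs fss IH] n //=.
case/and5P=> fs_known fs_lt /Pos.eqb_eq nE /eqP kE run [_|i i_lt].
  rewrite addn0 -nE tau_factored //.
  by apply: sub_all fs_known => f; apply: known_primeP.
by rewrite addnS -addSn -Pos2Nat.inj_succ; apply: IH i_lt.
Qed.

(** * A run of length 11 *)

(** Larger entries rely on earlier ones, so the order matters. The primes q
listed with p have a product exceeding the square root of p; they are chosen to
make the recursive verification cheap. *)
Definition prime_certificates : seq (positive * positive * seq positive) := [::
  (170141, 125233, [:: 181; 5]);
  (1852817, 121862, [:: 233; 7]);
  (97843560137, 51201060044, [:: 1852817]);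
  (3325913650599875185816279,
   1515367212655176386973142,
   [:: 97843560137; 113]);
  (5901752546491751518750903104784621886819,
   5359138743462775126278259957407871231800,
   [:: 3325913650599875185816279]);
  (56656128039520328553329457199366005528079755359,
   55854139716720982951538467937948129458647703401,
   [:: 5901752546491751518750903104784621886819]);
  (137999801, 2409196, [:: 2749; 5]);
  (19043972539, 9466281329, [:: 137999801]);
  (98389, 85586, [:: 911]);
  (392142312285091993912110485219,
   357205004228175401356676428818,
   [:: 19043972539; 98389]);
  (1572135391328288602241078673628581587,
   1261477836799060904112935897005856720,
   [:: 392142312285091993912110485219]);
  (2884693168952637855056250609036924323696380966892872651,
   2593840609605297887275458691082973774364472061483672555,
   [:: 1572135391328288602241078673628581587]);
  (8177303, 2381124, [:: 1627; 2]);
  (16354607, 6761744, [:: 8177303]);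
  (269197574929398719, 80442954032695072, [:: 16354607; 79]);
  (4707581, 3444569, [:: 2083; 2]);
  (84736459, 59385572, [:: 4707581]);
  (1016837509, 897138716, [:: 84736459]);
  (115987, 71519, [:: 1487]);
  (2093203333600209019609489,
   509498366535923822271779,
   [:: 1016837509; 115987]);
  (3952517587791886319636337917551640419,
   2370223324691236098140471448057658042,
   [:: 2093203333600209019609489]);
  (228985037, 51918620, [:: 3617; 7]);
  (5953610963, 5095140856, [:: 228985037]);
  (868313, 506956, [:: 349; 311]);
  (5560676453, 619537889, [:: 868313]);
  (1093122693055661069888583621184253,
   626102345813322809224475641703140,
   [:: 5953610963; 5560676453]);
  (333943955666810571791314154912352541311536733239999,
   229089518721970344684012306140808517020616254404207,
   [:: 1093122693055661069888583621184253]);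
  (18427, 3579, [:: 83; 3]);
  (46411, 6723, [:: 17; 13]);
  (24133721, 19152365, [:: 46411]);
  (5761803579051973, 1996777185826378, [:: 24133721; 487]);
  (543508108328218877623231,
   269600922502810891438481,
   [:: 5761803579051973]);
  (66577716781645510300075421192880590343696437,
   58839655660600304523180004220220316027801899,
   [:: 543508108328218877623231]);
  (49267510418417677622055811682731636854335363381,
   43971149181182991858399315451198800662433018986,
   [:: 66577716781645510300075421192880590343696437]);
  (302261, 222108, [:: 127; 7]);
  (432233231, 344040626, [:: 302261]);
  (209801, 89521, [:: 1049]);
  (33703, 1060, [:: 137; 3]);
  (202219, 174375, [:: 33703]);
  (239338176254491305313390462183610817053,
   94759062276441137998953732908940202211,
   [:: 432233231; 209801; 202219]);
  (9089788370918468241192873012850725082480783775886395593,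
   6678292434093049591394680640115703500808387633663687109,
   [:: 239338176254491305313390462183610817053]);
  (103573, 83802, [:: 137; 3]);
  (27103, 13781, [:: 4517]);
  (959654159313379, 564348434845841, [:: 103573; 27103]);
  (55659941240175983, 25181367860373441, [:: 959654159313379]);
  (111319882480351967, 79445359606654612, [:: 55659941240175983]);
  (194521277, 42546698, [:: 881; 17]);
  (559443192653, 237575818048, [:: 194521277]);
  (68659527601331532916017963844301518203543072927275651,
   57345792249587597858026966765722180981569945389088142,
   [:: 111319882480351967; 559443192653]);
  (13477, 570, [:: 1123]);
  (1109094378043, 198458657716, [:: 13477; 281]);
  (12841, 10485, [:: 107; 2]);
  (3364343, 1129365, [:: 12841]);
  (998079451753, 504011381026, [:: 3364343]);
  (90627740088390507545085800648505183331806472367,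
   19584584204616308725052516975715952121490513433,
   [:: 1109094378043; 998079451753]);
  (2244667866509256090876685110462176380762182707585857,
   1057490204635498593760079412922238378968690674094718,
   [:: 90627740088390507545085800648505183331806472367]);
  (46549, 43912, [:: 431]);
  (33427855857611, 14810310589332, [:: 46549; 149]);
  (66855711715223, 56208519399056, [:: 33427855857611]);
  (513086432652677231083,
   158823908595358219549,
   [:: 66855711715223]);
  (18471111575496380318989,
   4602962843644789367268,
   [:: 513086432652677231083]);
  (533976155682560568662403046103,
   255880330054223452614845701890,
   [:: 18471111575496380318989]);
  (7914209663415278173915415735279423676269773,
   5060123159790260055276489703115402919098064,
   [:: 533976155682560568662403046103]);
  (373803950822430418710372916008717739077573918337,
   120794250783395295241543906452704286866033106956,
   [:: 7914209663415278173915415735279423676269773]);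
  (6707538093557691433338931604860431110007986390639129,
   2999574710675382870408078242175476232571677357843324,
   [:: 373803950822430418710372916008717739077573918337]);
  (1457201, 267613, [:: 3643]);
  (349728241, 196950309, [:: 1457201]);
  (190788715538334083791,
   94981756348368931320,
   [:: 349728241; 317]);
  (382703, 54442, [:: 1069]);
  (2258673304889, 1996548516805, [:: 382703; 7]);
  (528217831056798746886509056033,
   317748918815430448375287610574,
   [:: 2258673304889; 9337]);
  (5441700095547140690424816295251967,
   2470751799987670945071014722723176,
   [:: 528217831056798746886509056033]);
  (108007, 87480, [:: 383]);
  (74322664657541, 47247400580364, [:: 108007; 233]);
  (77951, 47112, [:: 1559]);
  (260979949, 111414399, [:: 77951]);
  (35606481990197017, 1435802602591826, [:: 260979949]);
  (2274826921389707022097,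
   711899586493453021381,
   [:: 35606481990197017]);
  (1923132347671731722440596945004599727609,
   994911750286684512709563681441683800158,
   [:: 2274826921389707022097])]%positive.

Definition run_start : positive := 6980957468865383609236126473869356863345241939880751815419.

Definition run_factorizations : seq (seq (positive * nat)) := [::
  [:: (23%positive, 2);
      (37%positive, 2);
      (170141%positive, 1);
      (56656128039520328553329457199366005528079755359%positive, 1)];
  [:: (2%positive, 2);
      (5%positive, 1);
      (11%positive, 2);
      (2884693168952637855056250609036924323696380966892872651%positive, 1)];
  [:: (3%positive, 8);
      (269197574929398719%positive, 1);
      (3952517587791886319636337917551640419%positive, 1)];
  [:: (2%positive, 1);
      (53%positive, 2);
      (61%positive, 2);
      (333943955666810571791314154912352541311536733239999%positive, 1)];
  [:: (47%positive, 2);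
      (59%positive, 2);
      (18427%positive, 1);
      (49267510418417677622055811682731636854335363381%positive, 1)];
  [:: (2%positive, 8);
      (3%positive, 1);
      (9089788370918468241192873012850725082480783775886395593%positive, 1)];
  [:: (5%positive, 2);
      (7%positive, 2);
      (83%positive, 1);
      (68659527601331532916017963844301518203543072927275651%positive, 1)];
  [:: (2%positive, 1);
      (29%positive, 2);
      (43%positive, 2);
      (2244667866509256090876685110462176380762182707585857%positive, 1)];
  [:: (3%positive, 1);
      (19%positive, 2);
      (31%positive, 2);
      (6707538093557691433338931604860431110007986390639129%positive, 1)];
  [:: (2%positive, 2);
      (41%positive, 2);
      (190788715538334083791%positive, 1);
      (5441700095547140690424816295251967%positive, 1)];
  [:: (13%positive, 2);
      (17%positive, 2);
      (74322664657541%positive, 1);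
      (1923132347671731722440596945004599727609%positive, 1)]].

Lemma prime_certificates_ok : all pos_prime [seq c.1.1 | c <- prime_certificates].
Proof. by apply: (@check_certificatesP [::]); vm_compute. Qed.

Lemma run_factorizations_ok :
  check_run [seq c.1.1 | c <- prime_certificates] 36 run_start run_factorizations.
Proof. by vm_compute. Qed.

Lemma run_of_factorizations :
  equidivisor_run 36 (Pos.to_nat run_start) (size run_factorizations).
Proof. exact: (check_runP prime_certificates_ok run_factorizations_ok). Qed.

Theorem lemma7 : 11 <= M 36 <= 15.
Proof.
apply: M_bounds; last exact: no_run16.
(* The length is rewritten beforehand: comparing the two statements of the run
   up to conversion could unfold its unary first term. *)
have <- : size run_factorizations = 11 by [].
by exists (Pos.to_nat run_start); exact: run_of_factorizations.
Qed.
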